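(* Let $E$ be a non-zero Banach space. Then, for each maximal left ideal $\mathscr{L}$ of $\mathscr{B}(E)$, exactly one of the following two alternatives holds: (i) $\mathscr{L}$ is fixed; or (ii) $\mathscr{L}$ contains $\mathscr{E}(E)$.
   Context: All Banach spaces are complex; $\mathscr{B}(E)$ is the Banach algebra of bounded linear operators on $E$ and $I_E$ is its identity. A Fredholm operator is one with finite-dimensional kernel and finite-codimensional range. An operator $T\in\mathscr{B}(E)$ is inessential if $I_E-ST$ is a Fredholm operator for each $S\in\mathscr{B}(E)$; $\mathscr{E}(E)$ denotes the set of inessential operators on $E$ (a closed two-sided ideal of $\mathscr{B}(E)$). A maximal left ideal is fixed if it equals $\{T\in\mathscr{B}(E): Tx=0\}$ for some $x\in E\setminus\{0\}$. *)

(* Defs.v *)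
From HB Require Import structures.
From mathcomp Require Import all_boot all_order all_algebra.
From mathcomp Require Import complex.
From mathcomp Require Import all_classical all_reals all_analysis.

Set Implicit Arguments.
Unset Strict Implicit.
Unset Printing Implicit Defensive.

Import Order.TTheory GRing.Theory Num.Theory.
Import numFieldNormedType.Exports.

Local Open Scope classical_set_scope.
Local Open Scope ring_scope.

Section BoundedOperators.
Variables (K : numFieldType) (E : normedModType K).

Definition norm_bounded (f : E -> E) : Prop :=
  exists M : K, forall x, `|f x| <= M * `|x|.

Definition bounded_linear : {pred E -> E} :=
  [pred f | `[< linear f /\ norm_bounded f >]].

Lemma bounded_linearP f :
  reflect (linear f /\ norm_bounded f) (f \in bounded_linear).
Proof. exact: asboolP. Qed.

Lemma norm_bounded_ge0 f : norm_bounded f ->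
  exists2 M : K, 0 <= M & forall x, `|f x| <= M * `|x|.
Proof.
move=> [M fM]; have [[x x0]|noE] := pselect (exists x : E, x != 0).
  exists M => //; rewrite -(pmulr_lge0 M (x := `|x|)) ?normr_gt0//.
  exact: le_trans (fM x).
exists 0 => // x; suff -> : x = 0 by have := fM 0; rewrite normr0 !mulr0.
by apply: contrapT => /eqP x0; apply: noE; exists x.
Qed.

Lemma bounded_linear_submod : submod_closed bounded_linear.
Proof.
split.
  apply/bounded_linearP; split; first by move=> a x y; rewrite scaler0 addr0.
  by exists 0 => x; rewrite normr0 mul0r.
move=> a f g /bounded_linearP[fl [M fM]] /bounded_linearP[gl [N gN]].
apply/bounded_linearP; split.
  move=> b x y; rewrite /= !fctE fl gl !scalerDr !scalerA mulrC.
  by rewrite addrACA.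
exists (`|a| * M + N) => x; rewrite !fctE mulrDl (le_trans (ler_normD _ _))//.
by rewrite lerD// normrZ -mulrA ler_wpM2l.
Qed.

HB.instance Definition _ := GRing.isSubmodClosed.Build K (E -> E) bounded_linear
  bounded_linear_submod.

Record bounded_op := BoundedOp {
  bounded_op_fun : E -> E;
  _ : bounded_op_fun \in bounded_linear }.

HB.instance Definition _ := [isSub for bounded_op_fun].
HB.instance Definition _ := [Choice of bounded_op by <:].
HB.instance Definition _ := [SubChoice_isSubLmodule of bounded_op by <:].

Local Notation app := bounded_op_fun.

Lemma bounded_op_linear (T : bounded_op) : linear (app T).
Proof. by have /bounded_linearP[] := valP T. Qed.

Lemma bounded_op_bounded (T : bounded_op) : norm_bounded (app T).
Proof. by have /bounded_linearP[] := valP T. Qed.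

HB.instance Definition _ (T : bounded_op) :=
  GRing.isLinear.Build K E E *:%R (app T) (bounded_op_linear T).

Lemma bounded_op_eqP (S T : bounded_op) : app S =1 app T -> S = T.
Proof. by move=> ST; apply: val_inj; apply/funext. Qed.

Lemma id_bounded_linear : idfun \in bounded_linear.
Proof. by apply/bounded_linearP; split=> //; exists 1 => x; rewrite mul1r. Qed.

Lemma comp_bounded_linear (S T : bounded_op) : app S \o app T \in bounded_linear.
Proof.
apply/bounded_linearP; split; first by move=> a x y; rewrite /= !linearP.
have [M M0 SM] := norm_bounded_ge0 (bounded_op_bounded S).
have [N TN] := bounded_op_bounded T.
exists (M * N) => x; rewrite (le_trans (SM _))// -mulrA.
by rewrite ler_wpM2l.
Qed.

Definition bounded_op_id : bounded_op := BoundedOp id_bounded_linear.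
Definition bounded_op_comp (S T : bounded_op) : bounded_op :=
  BoundedOp (comp_bounded_linear S T).

Fact bop_mulA : associative bounded_op_comp.
Proof. by move=> S T U; apply: bounded_op_eqP. Qed.
Fact bop_mul1l : left_id bounded_op_id bounded_op_comp.
Proof. by move=> T; apply: bounded_op_eqP. Qed.
Fact bop_mul1r : right_id bounded_op_id bounded_op_comp.
Proof. by move=> T; apply: bounded_op_eqP. Qed.
Fact bop_mulDl : left_distributive bounded_op_comp +%R.
Proof. by move=> S T U; apply: bounded_op_eqP. Qed.
Fact bop_mulDr : right_distributive bounded_op_comp +%R.
Proof. by move=> S T U; apply: bounded_op_eqP => x; exact: linearD. Qed.

HB.instance Definition _ := GRing.Zmodule_isPzRing.Build bounded_op
  bop_mulA bop_mul1l bop_mul1r bop_mulDl bop_mulDr.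

Lemma bounded_op_scaleAl (a : K) (S T : bounded_op) :
  a *: (S * T) = a *: S * T.
Proof. exact: bounded_op_eqP. Qed.

Lemma bounded_op_scaleAr (a : K) (S T : bounded_op) :
  a *: (S * T) = S * (a *: T).
Proof. by apply: bounded_op_eqP => x; rewrite /= [RHS]linearZ. Qed.

End BoundedOperators.

Coercion bounded_op_fun : bounded_op >-> Funclass.
Notation "''B' ( E )" := (bounded_op E)
  (at level 8, format "''B' ( E )") : type_scope.

Section LeftIdeals.
Variable A : pzRingType.

(* In a unital algebra such an L is automatically a linear subspace, because
   a *: T = (a *: 1) * T; see left_idealZ. *)
Definition left_ideal (L : set A) : Prop :=
  [/\ L 0,
      forall S T, L S -> L T -> L (S + T) &
      forall S T, L T -> L (S * T)].

Definition maximal_left_ideal (L : set A) : Prop :=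
  [/\ left_ideal L, L <> setT &
      forall J : set A, left_ideal J -> J <> setT -> L `<=` J -> J = L].

End LeftIdeals.

Lemma left_idealZ (K : numFieldType) (E : normedModType K) (L : set 'B(E))
    (a : K) (T : 'B(E)) : left_ideal L -> L T -> L (a *: T).
Proof.
by move=> [_ _ LM] LT; rewrite -[T]mul1r bounded_op_scaleAl; exact: LM.
Qed.

Section FiniteDimension.
Variables (K : pzRingType) (V : lmodType K).

Definition lin_span n (v : 'I_n -> V) : set V :=
  [set \sum_(i < n) c i *: v i | c in [set: 'I_n -> K]].

Definition finite_dim (W : set V) : Prop :=
  exists n (v : 'I_n -> V), W = lin_span v.

(* the classes of v span the quotient V / W *)
Definition finite_codim (W : set V) : Prop :=
  exists n (v : 'I_n -> V),
    [set w + u | w in W & u in lin_span v] = setT.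

End FiniteDimension.

Section Fredholm.
Variables (K : numFieldType) (E : normedModType K).

Definition fredholm (T : 'B(E)) : Prop :=
  finite_dim [set x | T x = 0] /\ finite_codim (range T).

Definition inessential : set 'B(E) :=
  [set T | forall S : 'B(E), fredholm (1 - S * T)].

Definition fixed_left_ideal (L : set 'B(E)) : Prop :=
  exists2 x : E, x != 0 & L = [set T | T x = 0].

End Fredholm.

Arguments inessential {K} E.

(* Main.v *)
Require Import Defs.
From HB Require Import structures.
From mathcomp Require Import all_boot all_order all_algebra.
From mathcomp Require Import complex ring lra.
From mathcomp Require Import all_classical all_reals all_analysis.

Set Implicit Arguments.
Unset Strict Implicit.
Unset Printing Implicit Defensive.

Import Order.TTheory GRing.Theory Num.Theory.
Import numFieldNormedType.Exports.

Local Open Scope classical_set_scope.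
Local Open Scope ring_scope.

(** Let L be a maximal left ideal that misses an inessential operator T.  By
maximality L + B(E) T is everything, so 1 = U + S T with U in L, and
U = 1 - S T is Fredholm.  A Fredholm operator is left invertible up to finite
rank: there is a bounded V such that Q = 1 - V U has finite-dimensional range
([fredholm_left_parametrix]).  Hence 1 - Q is in L.  If L were not fixed, the
operators of L would have no common non-zero kernel vector, and then Q can be
peeled off one dimension at a time ([left_ideal_unit]): for a spanning vector
x of the range of Q pick T in L with T x <> 0 and a rank-one S sending T x
back to x; A = S T is in L, fixes x, and
1 - (1 - A) Q = (1 - Q) + A - A (1 - Q) is again in L, while the range of
(1 - A) Q needs one generator fewer.  Eventually 1 is in L, a contradiction.

The two alternatives exclude each other because the left ideal of operators
killing x misses every rank-one operator fixing x, although rank-one operators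
are inessential ([rank_one_inessential]).

Two theorems of functional analysis carry the argument.  Rank-one operators
with a prescribed value come from the theorem of Hahn and Banach, and the
operator V, which is easily defined algebraically, is bounded by the closed
graph theorem.  Both are proved for real scalars and transferred to E, seen
as a real Banach space ([realify]). *)

(** * The Hahn-Banach theorem *)

Section HahnBanach.
Variables (R : realType) (V : lmodType R).
Implicit Types (p q : V -> R) (x y : V).

(** Homogeneity is asked as an inequality for t > 0, the form that passes to
infima without a case analysis; equality follows, see [sublinearZ]. *)
Definition sublinear p :=
  (forall x y, p (x + y) <= p x + p y) /\
  (forall t x, 0 < t -> p (t *: x) <= t * p x).

Lemma sublinear0 p : sublinear p -> p 0 = 0.
Proof.
move=> [pD pZ]; apply/eqP; rewrite eq_le; apply/andP; split.
  have := pZ 2^-1 0; rewrite invr_gt0 ltr0n scaler0 => /(_ isT).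
  by lra.
by have := pD 0 0; rewrite addr0; lra.
Qed.

Lemma sublinearZ p t x : sublinear p -> 0 <= t -> p (t *: x) = t * p x.
Proof.
move=> sp; rewrite le_eqVlt => /predU1P[<-|t0].
  by rewrite scale0r mul0r sublinear0.
have [pD pZ] := sp; apply/eqP; rewrite eq_le pZ//=.
by rewrite -ler_pdivlMl// -[in leLHS](scalerK (lt0r_neq0 t0) x) pZ// invr_gt0.
Qed.

Lemma sublinearN p x : sublinear p -> - p (- x) <= p x.
Proof.
by move=> sp; have := sp.1 x (- x); rewrite subrr sublinear0//; lra.
Qed.

(** The largest sublinear functional q below p with q (- x) <= - p x, which
makes q (- x) = - q x.  It does two jobs: it shows that
minimal sublinear functionals are additive, and it forces the value of the
extension at a chosen point. *)
Definition pinned p x y :=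
  inf [set p (y + t *: x) - t * p x | t in [set t | 0 <= t]].

Lemma pinned_le p x t y : sublinear p -> 0 <= t ->
  pinned p x y <= p (y + t *: x) - t * p x.
Proof.
move=> sp t0; apply: ge_inf; last by exists t.
exists (- p (- y)) => _ [s /= s0 <-].
have := sp.1 (y + s *: x) (- y).
by rewrite addrAC subrr add0r sublinearZ//; lra.
Qed.

Lemma le_pinned p x y a :
  (forall t, 0 <= t -> a <= p (y + t *: x) - t * p x) -> a <= pinned p x y.
Proof.
move=> pa; apply: lb_le_inf; first by exists (p (y + 0 *: x) - 0 * p x), 0 => /=.
by move=> _ [t /= t0 <-]; exact: pa.
Qed.

Lemma pinned_sublinear p x : sublinear p -> sublinear (pinned p x).
Proof.
move=> sp; split=> [y z|t y t0].
  rewrite -lerBlDr; apply: le_pinned => s s0.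
  rewrite lerBlDr -lerBlDl; apply: le_pinned => t t0; rewrite lerBlDl.
  apply: le_trans (pinned_le _ _ sp (addr_ge0 s0 t0)) _.
  have := sp.1 (y + s *: x) (z + t *: x); rewrite addrACA -scalerDl.
  by rewrite mulrDl; lra.
rewrite -ler_pdivrMl//; apply: le_pinned => s s0; rewrite ler_pdivrMl//.
apply: le_trans (pinned_le _ _ sp (mulr_ge0 (ltW t0) s0)) _.
by rewrite -scalerA -scalerDr sublinearZ ?(ltW t0)// mulrBr mulrA.
Qed.

(** Zorn's lemma, for the pointwise order reversed: the infimum of a chain is
finite because - p (- x) is a lower bound at x, and it is subadditive because
two members of a chain are comparable. *)
Lemma exists_minimal_sublinear p : sublinear p ->
  exists q, [/\ sublinear q, (forall x, q x <= p x) &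
    forall q', sublinear q' -> (forall x, q' x <= q x) -> q' = q].
Proof.
move=> sp; pose T := {q | sublinear q /\ forall x, q x <= p x}.
pose below (s t : T) := `[< forall x, sval t x <= sval s x >].
have belowP s t : reflect (forall x, sval t x <= sval s x) (below s t).
  exact: asboolP.
have [|r s t /belowP rs /belowP st|s t /belowP st /belowP ts|A Atot|] :=
    @Zorn T below.
- by move=> t; exact/belowP.
- by apply/belowP => x; exact: le_trans (rs x).
- case: s t st ts => [s ?] [t ?] /= st ts.
  by apply/eq_exist/funext => x; apply/eqP; rewrite eq_le ts st.
- have [[s0 As0]|A0] := pselect (exists s, A s); last first.
    by exists (exist _ p (conj sp (fun=> lexx _))) => s As; case: A0; exists s.
  pose m x := inf [set sval s x | s in A].
  have m_le s x : A s -> m x <= sval s x.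
    move=> As; apply: ge_inf; last by exists s.
    exists (- p (- x)) => _ [t At <-]; have [st tp] := svalP t.
    by apply: le_trans (sublinearN x st); rewrite lerN2.
  have le_minf x a : (forall s, A s -> a <= sval s x) -> a <= m x.
    move=> Aa; apply: lb_le_inf; first by exists (sval s0 x), s0.
    by move=> _ [s As <-]; exact: Aa.
  have sm : sublinear m.
    split=> [x y|t x t0].
      rewrite -lerBlDr; apply: (le_minf) => s As.
      rewrite lerBlDr -lerBlDl; apply: (le_minf) => t At; rewrite lerBlDl.
      have [/belowP st|/belowP ts] := Atot s t As At.
        apply: le_trans (m_le _ _ At) _.
        by apply: le_trans ((svalP t).1.1 _ _) _; rewrite lerD2r.
      apply: le_trans (m_le _ _ As) _.
      by apply: le_trans ((svalP s).1.1 _ _) _; rewrite lerD2l.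
    rewrite -ler_pdivrMl//; apply: (le_minf) => s As; rewrite ler_pdivrMl//.
    by apply: le_trans (m_le _ _ As) _; apply: (svalP s).1.2.
  have mp x : m x <= p x by exact: le_trans (m_le _ _ As0) ((svalP s0).2 x).
  by exists (exist _ m (conj sm mp)) => s As; apply/belowP => x /=; exact: m_le.
move=> [q [sq qp]] qmin; exists q; split => // q' sq' q'q.
have q'p x : q' x <= p x by exact: le_trans (qp x).
apply: (congr1 sval (qmin (exist _ q' (conj sq' q'p)) _)).
exact/belowP.
Qed.

(** By minimality q coincides with [pinned q x], and comparing the two at time
t = 1 gives q y <= q (y + x) - q x, the inequality opposite to
subadditivity. *)
Lemma minimal_sublinear_linear q : sublinear q ->
  (forall q', sublinear q' -> (forall x, q' x <= q x) -> q' = q) -> scalar q.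
Proof.
move=> sq qmin.
have qD x y : q (x + y) = q x + q y.
  apply/eqP; rewrite eq_le sq.1/=.
  have := pinned_le x y sq ler01.
  rewrite (qmin (pinned q x)); [|exact: pinned_sublinear|].
    by rewrite scale1r mul1r [y + x]addrC; lra.
  move=> z; apply: le_trans (pinned_le _ _ sq (lexx 0)) _.
  by rewrite scale0r mul0r addr0 subr0.
have qN x : q (- x) = - q x.
  by have := qD x (- x); rewrite subrr sublinear0//; lra.
move=> t x y; rewrite qD; congr (_ + _).
have [t0|t0] := leP 0 t; first by rewrite sublinearZ.
rewrite -[t]opprK scaleNr qN sublinearZ ?mulNr// oppr_ge0; exact: ltW.
Qed.

(** The form of the theorem that produces a functional supporting p at x0: a
minimal sublinear functional below [pinned p x0] is linear, and its value at
- x0 is at most - p x0. *)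
Theorem Hahn_Banach p x0 : sublinear p ->
  exists f : V -> R, [/\ scalar f, (forall x, f x <= p x) & f x0 = p x0].
Proof.
move=> sp.
have [f [sf fp fmin]] := exists_minimal_sublinear (pinned_sublinear x0 sp).
have lf := minimal_sublinear_linear sf fmin.
have f_le x : f x <= p x.
  apply: le_trans (fp x) _; apply: le_trans (pinned_le _ _ sp (lexx 0)) _.
  by rewrite scale0r mul0r addr0 subr0.
exists f; split => //; apply/eqP; rewrite eq_le f_le/=.
have := le_trans (fp (- x0)) (pinned_le _ _ sp ler01).
rewrite scale1r mul1r addNr sublinear0// sub0r.
by have := lf (- 1) x0 0; rewrite addr0 sublinear0// addr0 scaleN1r; lra.
Qed.

End HahnBanach.

(** * The closed graph theorem *)

Section ClosedGraph.
Variables (R : realType) (X Y : completeNormedModType R).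
Variable f : {linear X -> Y}.

(** Where completeness of the domain enters.  The closures of the sets
[|f y| <= n] cover X, so by Baire's theorem one of them contains a ball;
symmetrizing moves the ball to the origin and rescaling makes the estimate
uniform.  The points found only approximate z, hence the factor 1/2. *)
Lemma closed_graph_approx : exists2 K : R, 0 <= K &
  forall z, exists u, `|f u| <= K * `|z| /\ `|z - u| <= 2^-1 * `|z|.
Proof.
pose A n := [set y | `|f y| <= n%:R].
have [n [a [r [r0 arA]]]] :
    exists n a (r : R), [/\ 0 < r & ball a r `<=` closure (A n)].
  apply: contrapT => noA.
  suff /(_ setT) : dense (\bigcap_n ~` closure (A n)).
    case; [by exists 0|exact: openT|move=> y [_] yA].
    have := yA (Num.truncn `|f y|).+1 Logic.I; apply; apply: subset_closure.
    by rewrite /A/= ltW// truncnS_gt.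
  apply: Baire => n; split; first by apply: closed_openC; exact: closed_closure.
  apply: contrapT => /denseNE[D [[a /open_nbhs_nbhs/nbhs_ballP[r /= r0 arD]] DA]].
  apply: noA; exists n, a, r; split => // y ary; apply: contrapT => yA.
  by suff : set0 y by []; rewrite -DA; split => //; exact: arD.
have close z e : `|z| < r -> 0 < e -> exists2 u, `|f u| <= n%:R & `|z - u| < e.
  move=> zr e0.
  have aA w : `|w| < r -> exists2 u, A n u & `|a + w - u| < e.
    move=> wr; have /arA/(_ (ball (a + w) e)) : ball a r (a + w).
      by rewrite -ball_normE/= opprD addNKr normrN.
    case; first exact: nbhsx_ballx.
    by move=> u [Au]; rewrite -ball_normE => ?; exists u.
  have [u Au ue] := aA z zr.
  have [|v Av ve] := aA (- z); first by rewrite normrN.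
  exists (2^-1 *: (u - v)).
    rewrite linearZ/= linearB normrZ ger0_norm ?invr_ge0// ler_pdivrMl//.
    rewrite (le_trans (ler_normB _ _))// mulr_natl mulr2n lerD//.
  have -> : z - 2^-1 *: (u - v) = 2^-1 *: ((a + z - u) - (a - z - v)).
    rewrite -[z in LHS](scalerK (_ : (2 : R) != 0))// -scalerBr; congr (_ *: _).
    rewrite scaler_nat mulr2n !opprB.
    by rewrite [RHS](AC (3*(1*2)) ((1*6)*((2*5)*(4*3))))/= subrr add0r.
  rewrite normrZ ger0_norm ?invr_ge0// ltr_pdivrMl//.
  by rewrite (le_lt_trans (ler_normB _ _))// mulr_natl mulr2n ltrD.
exists (2 * n%:R / r); first by rewrite divr_ge0 ?mulr_ge0// ltW.
move=> z; have [->|z0] := eqVneq z 0.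
  by exists 0; rewrite linear0 subrr !normr0 !mulr0.
have nz0 : 0 < `|z| by rewrite normr_gt0.
pose c := r / (2 * `|z|); have c0 : 0 < c by rewrite divr_gt0// mulr_gt0.
have cz : `|c *: z| = r / 2.
  rewrite normrZ gtr0_norm// /c; field; rewrite ?lt0r_neq0//.
have [||u fu cu] := close (c *: z) (2^-1 * `|c *: z|).
- by rewrite cz; lra.
- by rewrite cz; lra.
exists (c^-1 *: u); split.
  rewrite linearZ/= normrZ gtr0_norm ?invr_gt0// ler_pdivrMl//.
  rewrite (le_trans fu)// le_eqVlt; apply/orP; left; apply/eqP.
  by rewrite /c; field; rewrite ?lt0r_neq0.
rewrite -[z in X in X <= _](scalerK (lt0r_neq0 c0)) -scalerBr normrZ.
rewrite gtr0_norm ?invr_gt0// ler_pdivrMl// (le_trans (ltW cu))//.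
by rewrite normrZ gtr0_norm// mulrCA.
Qed.

(** Iterating the approximation writes z as a series whose image under f is
dominated by a geometric series; the closed graph identifies f z with the sum
of the image series. *)
Theorem closed_graph :
  (forall (u : nat -> X) x y, u @ \oo --> x -> f \o u @ \oo --> y -> f x = y) ->
  exists M, forall x, `|f x| <= M * `|x|.
Proof.
move=> fclosed; have [K K0 /choice[g gP]] := closed_graph_approx.
(* 2 is the sum of the powers of 1/2 *)
exists (2 * K) => z.
pose rest k := iter k (fun y => y - g y) z.
have restP k : `|rest k| <= 2^-1 ^+ k * `|z|.
  elim: k => [|k IH]; first by rewrite expr0 mul1r.
  rewrite exprS -mulrA (le_trans (gP (rest k)).2)//.
  by rewrite ler_pM2l ?invr_gt0.
pose v k := f (g (rest k)).
have vP k : `|v k| <= geometric (K * `|z|) 2^-1 k.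
  rewrite /= mulrAC -mulrA (le_trans (gP _).1)// ler_wpM2l//.
have partial n : series (g \o rest) n = z - rest n.
  elim: n => [|n IH]; first by rewrite /series/= big_geq// subrr.
  by rewrite seriesSr IH /rest/= opprB addrA addrAC.
have half1 : `|2^-1 : R| < 1 by rewrite ger0_norm ?invr_ge0// invf_lt1// ltr1n.
have geo := @cvg_geometric_series R (K * `|z|) _ half1.
have cvn : cvgn [normed series v].
  apply: (@series_le_cvg R (fun n => `|v n|) (geometric (K * `|z|) 2^-1)) => //.
    by move=> n; rewrite /= !mulr_ge0// exprn_ge0// invr_ge0.
  exact: cvgP geo.
have fz : f z = limn (series v).
  apply: (fclosed (series (g \o rest))).
    rewrite (funext partial) -[X in _ --> X]subr0.
    apply: cvgB; first exact: cvg_cst.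
    apply/cvgr0Pnorm_lt => e e0.
    have /cvgr0Pnorm_lt/(_ _ e0) := @cvg_geometric R `|z| _ half1.
    apply: filterS => n; apply: le_lt_trans; rewrite (le_trans (restP n))//.
    by rewrite mulrC ler_norm.
  rewrite (_ : f \o _ = series v); first exact: normed_cvg.
  by apply/funext => n; rewrite /series/= linear_sum.
rewrite fz (le_trans (lim_series_norm cvn))//.
have -> : 2 * K * `|z| = limn (series (geometric (K * `|z|) 2^-1)).
  by rewrite (cvg_lim _ geo)//; field.
by apply: lim_series_le => //; exact: cvgP geo.
Qed.

End ClosedGraph.

(** * Restriction of scalars to the reals *)

(** A copy of E, so that its real structure does not compete with the complex
one during instance inference. *)
Definition realify (R : realType) (E : normedModType R[i]) : Type := E.

Section Realification.
Variables (R : realType).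

Section Normed.
Variable E : normedModType R[i].

HB.instance Definition _ := GRing.Zmodule.copy (realify E) E.

Definition real_scale (t : R) (x : realify E) : realify E :=
  (real_complex R t) *: (x : E).

Fact real_scaleA s t x : real_scale s (real_scale t x) = real_scale (s * t) x.
Proof. by rewrite /real_scale scalerA -rmorphM. Qed.
Fact real_scale1 : left_id 1 real_scale.
Proof. by move=> x; rewrite /real_scale rmorph1 scale1r. Qed.
Fact real_scaleDr : right_distributive real_scale +%R.
Proof. by move=> t x y; exact: scalerDr. Qed.
Fact real_scaleDl x : {morph real_scale^~ x : s t / s + t}.
Proof. by move=> s t; rewrite /real_scale rmorphD; exact: scalerDl. Qed.

HB.instance Definition _ := GRing.Zmodule_isLmodule.Build R (realify E)
  real_scaleA real_scale1 real_scaleDr real_scaleDl.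

Definition real_norm (x : realify E) : R := complex.Re `|x : E|.

Lemma real_normE (x : E) : `|x| = real_complex R (real_norm x).
Proof. by rewrite RRe_real// normr_real. Qed.

Fact real_normD x y : real_norm (x + y) <= real_norm x + real_norm y.
Proof. by rewrite -lecR rmorphD/= -!real_normE ler_normD. Qed.
Fact real_normZ t x : real_norm (t *: x) = `|t| * real_norm x.
Proof.
apply: complexI; rewrite rmorphM/= -!real_normE normrZ; congr (_ * _).
by rewrite normc_def/= expr0n addr0 sqrtr_sqr.
Qed.
Fact real_norm0_eq0 x : real_norm x = 0 -> x = 0.
Proof. by move=> x0; apply/eqP; rewrite -(normr_eq0 (x : E)) real_normE x0. Qed.

HB.instance Definition _ := Lmodule_isNormed.Build R (realify E)
  real_normD real_normZ real_norm0_eq0.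

End Normed.

Section Complete.
Variable E : completeNormedModType R[i].

(** A positive complex number is real, so balls of complex radius in E and balls
of real radius in the copy are the same sets. *)
Fact realify_complete (F : set_system (realify E)) :
  ProperFilter F -> cauchy F -> cvg F.
Proof.
move=> FF Fc.
have /cvg_ex[l Fl] : cvg (F : set_system E).
  apply: cauchy_cvg; apply/cauchy_ballP => e e0.
  have eE : e = real_complex R (complex.Re e) by rewrite RRe_real// gtr0_real.
  have e0' : 0 < complex.Re e by rewrite -ltcR -eE.
  move/cauchy_ballP : Fc => /(_ _ e0').
  apply: filterS => -[x y]; rewrite -!ball_normE/= => xy.
  by rewrite real_normE eE ltcR.
apply/cvg_ex; exists l; apply/cvgrPdist_lt => e e0.
have : 0 < real_complex R e by rewrite ltcR.
move/cvgrPdist_lt : Fl => /[apply]; apply: filterS => x.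
by rewrite real_normE ltcR.
Qed.

HB.instance Definition _ := Uniform_isComplete.Build (realify E) realify_complete.
End Complete.
End Realification.

(** * Bounded functionals and rank-one operators *)

Section RankOne.
Variables (R : realType) (E : normedModType R[i]).

Lemma norm_realC (t : R) : `|real_complex R t| = real_complex R `|t|.
Proof. by rewrite normc_def/= expr0n addr0 sqrtr_sqr. Qed.

(** The complex linear functional with real part f. *)
Definition complexify (f : realify E -> R) (x : E) : R[i] :=
  Complex (f x) (- f ('i%C *: x)).

Lemma complexify_scalar f : scalar f -> scalar (complexify f).
Proof.
move=> fl; have fD x y : f (x + y) = f x + f y.
  by have := fl 1 x y; rewrite scale1r mul1r.
have f0 : f 0 = 0 by have := fD 0 0; rewrite addr0; lra.
have fZ t x : f (real_complex R t *: (x : E)) = t * f x.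
  by have := fl t x 0; rewrite !addr0 f0 addr0.
have fc a b x : f (Complex a b *: (x : E)) = a * f x + b * f ('i%C *: (x : E)).
  by rewrite [Complex a b]complexE/= scalerDl fD -!fZ scalerA mulrC.
move=> [a b] x y; rewrite /complexify.
rewrite scalerDr scalerA !fD (_ : 'i%C * Complex a b = Complex (- b) a); last first.
  by simpc.
rewrite (fc a b) (fc (- b) a); apply/eqP; rewrite eq_complex/=.
by apply/andP; split; apply/eqP; ring.
Qed.

(** The constant 2 comes from bounding real and imaginary parts separately. *)
Lemma complexify_bounded f : scalar f -> (forall x, f x <= `|x|) ->
  forall x, `|complexify f x| <= 2 * `|x|.
Proof.
move=> fl fle.
have fN x : f (- x) = - f x.
  have f0 : f 0 = 0 by have := fl 1 0 0; rewrite scale1r mul1r addr0; lra.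
  by have := fl (- 1) x 0; rewrite !addr0 f0 addr0 scaleN1r mulN1r.
have fnorm x : `|f x| <= `|x|.
  by rewrite ler_norml fle andbT lerNl -fN -[leRHS]normrN.
move=> x; rewrite [complexify f x]complexE/= (le_trans (ler_normD _ _))//.
rewrite normrM !norm_realC normrN.
rewrite (_ : `|'i%C : R[i]| = 1); last first.
  by rewrite normc_def/= expr0n expr1n add0r sqrtr1.
rewrite mul1r mulr_natl mulr2n lerD// real_normE lecR ?fnorm//.
apply: le_trans (fnorm _) _; rewrite -lecR -!real_normE normrZ.
by rewrite normc_def/= expr0n expr1n add0r sqrtr1 mul1r.
Qed.

Lemma norm_sublinear (V : normedModType R) : sublinear (fun x : V => `|x|).
Proof.
by split=> [|t x t0]; [exact: ler_normD|rewrite normrZ gtr0_norm].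
Qed.

(** The operator z |-> (g z / g x) y, where g is a bounded functional whose real
part supports the norm at x. *)
Lemma exists_rank_one (x y : E) : x != 0 ->
  exists S : 'B(E), S x = y /\ forall z, exists c, S z = c *: y.
Proof.
move=> x0.
have [f [fl fle fx]] := Hahn_Banach (x : realify E) (norm_sublinear (realify E)).
have gl := complexify_scalar fl; have gM := complexify_bounded fl fle.
set g := complexify f in gl gM.
have gx0 : g x != 0.
  rewrite eq_complex/= fx; apply: contra x0 => /andP[+ _].
  by rewrite normr_eq0.
have Sbl : (fun z => (g z / g x) *: y) \in @bounded_linear _ E.
  apply/bounded_linearP; split.
    by move=> a u v; rewrite gl scalerA -scalerDl mulrDl mulrA.
  exists (2 / `|g x| * `|y|) => z; rewrite normrZ normrM normfV.
  rewrite [leRHS]mulrAC ler_wpM2r// mulrAC ler_wpM2r ?invr_ge0//.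
exists (BoundedOp Sbl); split; first by rewrite /= divff// scale1r.
by move=> z; exists (g z / g x).
Qed.

End RankOne.

(** * Spans and linear complements *)

Section Spans.
Variables (K : fieldType) (V : lmodType K).
Implicit Types (W : set V).

Definition linear_subspace W :=
  W 0 /\ forall a x y, W x -> W y -> W (a *: x + y).

Lemma lin_span_subset n (v : 'I_n -> V) W :
  linear_subspace W -> (forall i, W (v i)) -> lin_span v `<=` W.
Proof.
move=> [W0 WD] Wv _ [c _ <-]; elim/big_ind : _ => [//|x y Wx Wy|i _].
  by rewrite -[x]scale1r; exact: WD.
by rewrite -[_ *: _]addr0; exact: WD.
Qed.

Lemma lin_span_subspace n (v : 'I_n -> V) : linear_subspace (lin_span v).
Proof.
split; first by exists (fun=> 0) => //; rewrite big1// => i _; rewrite scale0r.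
move=> a _ _ [c _ <-] [d _ <-]; exists (fun i => a * c i + d i) => //.
rewrite scaler_sumr -big_split/=; apply: eq_bigr => i _.
by rewrite scalerDl scalerA.
Qed.

Lemma lin_span_mem n (v : 'I_n -> V) i : lin_span v (v i).
Proof.
exists (fun j => (j == i)%:R) => //.
rewrite (bigD1 i)//= eqxx scale1r big1 ?addr0// => j /negPf ->.
by rewrite scale0r.
Qed.

Lemma subspace_add W W' : linear_subspace W -> linear_subspace W' ->
  linear_subspace [set w + w' | w in W & w' in W'].
Proof.
move=> [W0 WD] [W'0 W'D]; split.
  by exists 0 => //; exists 0 => //; rewrite addr0.
move=> a _ _ [x Wx [x' W'x' <-]] [y Wy [y' W'y' <-]].
exists (a *: x + y); first exact: WD.
by exists (a *: x' + y'); [exact: W'D|rewrite scalerDr addrACA].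
Qed.

(** Induction on the number of generators: a non-trivial relation
sum c_i v_i in W allows one to discard a generator with c_i <> 0. *)
Lemma exists_linear_complement W : linear_subspace W -> finite_codim W ->
  exists n (v : 'I_n -> V), [set w + u | w in W & u in lin_span v] = setT /\
    forall z, W z -> lin_span v z -> z = 0.
Proof.
move=> sW [n [v]]; elim: n v => [|n IH] v WvT.
  by exists 0, v; split => // z _ [c _ <-]; rewrite big_ord0.
have [vW0|/existsNP[z /not_implyP[Wz /not_implyP[[c _ cz] z0]]]] :=
  pselect (forall z, W z -> lin_span v z -> z = 0); first by exists n.+1, v.
have [i ci] : exists i, c i != 0.
  apply: contrapT => /forallNP c0; apply: z0; rewrite -cz big1// => i _.
  by have /negP/negPn/eqP -> := c0 i; rewrite scale0r.
apply: (IH (v \o lift i)); apply/seteqP; split => // x _.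
have sv := lin_span_subspace (v \o lift i).
have sWv := subspace_add sW sv.
have : [set w + u | w in W & u in lin_span v] x by rewrite WvT.
move=> [w Ww [u vu <-]]; rewrite -[w]scale1r; apply: sWv.2.
  by exists w => //; exists 0; [exact: sv.1|rewrite addr0].
apply: (lin_span_subset sWv) vu => j.
have [k ->|->] := unliftP i j.
  exists 0; first exact: sW.1.
  exists (v (lift i k)); first exact: (lin_span_mem (v \o lift i)).
  by rewrite add0r.
exists ((c i)^-1 *: z).
  by rewrite -[_ *: _]addr0; apply: sW.2 => //; exact: sW.1.
exists (\sum_k (- (c i)^-1 * c (lift i k)) *: v (lift i k)).
  by exists (fun k => - (c i)^-1 * c (lift i k)).
rewrite -cz (bigD1_ord i)//= scalerDr scalerK// -addrA scaler_sumr -big_split/=.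
rewrite big1 ?addr0// => k _.
by rewrite scalerA -scalerDl mulNr subrr scale0r.
Qed.

End Spans.

(** * Finite-dimensional subspaces and left ideals *)

Section Operators.
Variables (R : realType).

Section Algebra.
Variable E : normedModType R[i].
Implicit Types (S T U : 'B(E)).

Lemma bounded_op_addE S T x : (S + T) x = S x + T x. Proof. by []. Qed.
Lemma bounded_op_subE S T x : (S - T) x = S x - T x. Proof. by []. Qed.
Lemma bounded_op_mulE S T x : (S * T) x = S (T x). Proof. by []. Qed.
Lemma bounded_op_1E x : (1 : 'B(E)) x = x. Proof. by []. Qed.
Lemma bounded_op_0E x : (0 : 'B(E)) x = 0. Proof. by []. Qed.

Definition bounded_opE := (bounded_op_subE, bounded_op_addE, bounded_op_mulE,
  bounded_op_1E, bounded_op_0E).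

Lemma bounded_op_linearP T a x y : T (a *: x + y) = a *: T x + T y.
Proof. exact: linearP. Qed.
Lemma bounded_op_linearZ T a x : T (a *: x) = a *: T x.
Proof. exact: linearZ. Qed.
Lemma bounded_op_linearD T x y : T (x + y) = T x + T y.
Proof. exact: linearD. Qed.
Lemma bounded_op_linearB T x y : T (x - y) = T x - T y.
Proof. exact: linearB. Qed.
Lemma bounded_op_linear0 T : T 0 = 0.
Proof. exact: linear0. Qed.

Lemma subspace_eq S T : linear_subspace [set x | S x = T x].
Proof.
split; first by rewrite /= !bounded_op_linear0.
by move=> a x y /= Sx Sy; rewrite !bounded_op_linearP Sx Sy.
Qed.

Lemma subspace_range T : linear_subspace (range T).
Proof.
split; first by exists 0; rewrite ?bounded_op_linear0.
by move=> a _ _ [x _ <-] [y _ <-]; exists (a *: x + y); rewrite ?bounded_op_linearP.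
Qed.

(** Finite-dimensional subspaces are complemented: a projection P onto the span
of all but one vector v0 is corrected by a rank-one operator fixing the defect
w = v0 - P v0, applied after 1 - P. *)
Lemma exists_projection n (v : 'I_n -> E) : exists P : 'B(E),
  (forall z, lin_span v (P z)) /\ forall z, lin_span v z -> P z = z.
Proof.
elim: n v => [|n IH] v.
  exists 0; split=> [z|z [c _ <-]]; last by rewrite big_ord0.
  exact: (lin_span_subspace v).1.
have [P [Pv Pid]] := IH (v \o lift ord0).
have subv : lin_span (v \o lift ord0) `<=` lin_span v.
  apply: lin_span_subset; first exact: lin_span_subspace.
  by move=> i; exact: lin_span_mem.
have Pvi i : P (v (lift ord0 i)) = v (lift ord0 i).
  by apply: Pid; exact: (lin_span_mem (v \o lift ord0)).
pose w := v ord0 - P (v ord0).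
have vw : lin_span v w.
  rewrite /w addrC -scaleN1r; apply: (lin_span_subspace v).2.
    exact/subv/Pv.
  exact: lin_span_mem.
have [w0|w0] := eqVneq w 0.
  exists P; split; first by move=> z; exact/subv/Pv.
  apply: (lin_span_subset (subspace_eq P 1)) => i /=.
  have [k ->|->] := unliftP ord0 i; first exact: Pvi.
  by apply/esym/eqP; rewrite -subr_eq0; exact/eqP.
have [S [Sw Sspan]] := exists_rank_one w w0.
exists (P + S * (1 - P)); split.
  move=> z; rewrite !bounded_opE addrC; have [c ->] := Sspan (z - P z).
  by apply: (lin_span_subspace v).2 => //; exact/subv/Pv.
apply: (lin_span_subset (subspace_eq (P + S * (1 - P)) 1)) => i.
change ((P + S * (1 - P)) (v i) = v i); rewrite !bounded_opE.
have [k ->|->] := unliftP ord0 i.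
  by rewrite Pvi subrr bounded_op_linear0 addr0.
by rewrite -/w Sw addrC subrK.
Qed.

(** The range of T S lies in the span of y = T x, so the kernel of 1 - T S is
either that span or zero, and z = (1 - T S) z + T S z shows that y spans the
quotient by the range. *)
Lemma rank_one_inessential S x :
  (forall z, exists c, S z = c *: x) -> inessential E S.
Proof.
move=> Sx T; set y := T x.
have TS z : exists c, (T * S) z = c *: y.
  by have [c Sz] := Sx z; exists c; rewrite !bounded_opE Sz bounded_op_linearZ.
have y_span : lin_span (fun _ : 'I_1 => y : E) = [set c *: y | c in [set: R[i]]].
  apply/seteqP; split=> [_ [c _ <-]|_ [c _ <-]].
    by exists (c ord0); rewrite ?big_ord1.
  by exists (fun=> c); rewrite ?(@big_ord1 _ _ _ (fun _ => c *: y)).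
split; last first.
  exists 1%N, (fun=> y); apply/seteqP; split => // z _.
  exists ((1 - T * S) z); first by exists z.
  exists ((T * S) z); last by rewrite !bounded_opE subrK.
  by rewrite y_span; have [c ->] := TS z; exists c.
have kerE z : (1 - T * S) z = 0 -> exists c, z = c *: y.
  rewrite bounded_op_subE bounded_op_1E => /eqP; rewrite subr_eq0 => /eqP zE.
  by have [c cz] := TS z; exists c; rewrite -cz.
have [y0|y0] := eqVneq ((1 - T * S) y) 0.
  exists 1%N, (fun=> y); rewrite y_span.
  apply/seteqP; split=> [z /kerE[c ->]|_ [c _ <-]].
    by exists c.
  by rewrite /mkset bounded_op_linearZ y0 scaler0.
exists 0%N, (fun=> y); apply/seteqP; split => [z z0|_ [c _ <-]]; last first.
  by rewrite big_ord0 /mkset bounded_op_linear0.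
exists (fun=> 0) => //; rewrite big_ord0; have [c zE] := kerE z z0; rewrite zE.
move: z0; rewrite /mkset zE bounded_op_linearZ => /eqP.
by rewrite scaler_eq0 (negPf y0) orbF => /eqP ->; rewrite scale0r.
Qed.

(** Finite-rank perturbations of the identity can be removed inside a left ideal
whose operators separate the points of E from 0. The induction is on the
number of vectors spanning the range of Q. *)
Lemma left_ideal_unit (L : set 'B(E)) n (v : 'I_n -> E) (Q : 'B(E)) :
  left_ideal L -> (forall x, x != 0 -> exists2 T, L T & T x != 0) ->
  (forall z, lin_span v (Q z)) -> L (1 - Q) -> L 1.
Proof.
move=> [L0 LD LM] Lsep; elim: n v Q => [|n IH] v Q Qv LQ.
  rewrite -[1]subr0 (_ : 0 = Q)//; apply: bounded_op_eqP => z.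
  by have [c _ <-] := Qv z; rewrite big_ord0.
(* A fixes a generator, so that 1 - A kills it *)
have [A LA Av] : exists2 A, L A & A (v ord0) = v ord0.
  have [->|v0] := eqVneq (v ord0) 0.
    by exists 0 => //; rewrite bounded_op_linear0.
  have [T LT Tv] := Lsep _ v0; have [S [SE _]] := exists_rank_one (v ord0) Tv.
  by exists (S * T); [exact: LM|rewrite bounded_op_mulE].
apply: (IH (fun i => (1 - A) (v (lift ord0 i))) ((1 - A) * Q)).
  set B := 1 - A; move=> z; rewrite bounded_op_mulE.
  set v' := fun i => B (v (lift ord0 i)).
  have sW := lin_span_subspace v'.
  apply: (@lin_span_subset _ _ _ v [set x | lin_span v' (B x)]) (Qv z).
    split; first by rewrite /mkset bounded_op_linear0; exact: sW.1.
    move=> a x y; rewrite /mkset => Bx By; rewrite bounded_op_linearP; exact: sW.2.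
  move=> i; have [k ->|->] := unliftP ord0 i.
    exact: (lin_span_mem v').
  by rewrite /mkset /B bounded_op_subE Av subrr; exact: sW.1.
have -> : 1 - (1 - A) * Q = (1 - Q) + (A + (- A) * (1 - Q)).
  by rewrite mulrBl mul1r mulNr mulrBr mulr1 !opprB [A + _]addrC subrK addrA addrAC.
by apply: (LD) => //; apply: (LD) => //; exact: LM.
Qed.

End Algebra.

(** * Fredholm operators *)

Section Banach.
Variable E : completeNormedModType R[i].
Implicit Types (S T U : 'B(E)).

Lemma bounded_op_cvg T (u : nat -> realify E) (x : realify E) :
  u @ \oo --> x -> (fun n => T (u n) : realify E) @ \oo --> (T x : realify E).
Proof.
move=> ux; have [M M0 TM] := norm_bounded_ge0 (bounded_op_bounded T).
have {}TM z : `|T z : realify E| <= (complex.Re M + 1) * `|z : realify E|.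
  rewrite -lecR rmorphM rmorphD/= -!real_normE (le_trans (TM z))// ler_wpM2r//.
  by rewrite RRe_real ?ger0_real// lerDl.
have M1 : 0 < complex.Re M + 1 by move: M0; rewrite lecE/= => /andP[_]; lra.
apply/cvgrPdist_lt => e e0.
have /cvgrPdist_lt/(_ (e / (complex.Re M + 1))) := ux.
rewrite divr_gt0// => /(_ isT); apply: filterS => n xun.
have -> : (T x : realify E) - T (u n) = T (x - u n) by rewrite bounded_op_linearB.
by rewrite (le_lt_trans (TM _))// mulrC -ltr_pdivlMr.
Qed.

Lemma bounded_op_cvg_eq S T (a b : nat -> realify E) (x y : realify E) :
  a @ \oo --> x -> b @ \oo --> y -> (forall n, S (a n) = T (b n)) -> S x = T y.
Proof.
move=> /(bounded_op_cvg (T := S)) Sx /(bounded_op_cvg (T := T)) Ty ST.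
apply: (norm_cvg_unique (V := realify E) Sx).
by rewrite (_ : (fun n => S (a n) : realify E) = fun n => T (b n));
  [exact: Ty|exact/funext].
Qed.

(** Let Q and P be projections onto the kernel of U and onto a complement of
its range.  For each y there is exactly one x in the kernel of Q for which
y - U x lies in the complement, and V y is that x.  Both conditions are closed
because they are equations between bounded operators; this is why the
complement is described by P, and it is what the closed graph theorem needs to
make V bounded. *)
Lemma fredholm_left_parametrix U : fredholm U ->
  exists (V Q : 'B(E)) n (v : 'I_n -> E),
    V * U = 1 - Q /\ forall z, lin_span v (Q z).
Proof.
move=> [[m [k kE]] codimU].
have [n [w [UwT Uw0]]] := exists_linear_complement (subspace_range U) codimU.
have [Q [Qk Qid]] := exists_projection k.
have [P [Pw Pid]] := exists_projection w.
have UQ x : U (Q x) = 0 by have := Qk x; rewrite -kE.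
have QQ x : Q (Q x) = Q x by exact/Qid/Qk.
pose solves y x := Q x = 0 /\ (P - 1) (U x) = (P - 1) y.
have solve y : exists x, solves y x.
  have : [set z + u | z in range U & u in lin_span w] y by rewrite UwT.
  move=> [_ [x _ <-] [s ws <-]]; exists (x - Q x); split.
    by rewrite bounded_op_linearB QQ subrr.
  rewrite bounded_op_linearB UQ subr0 [RHS]bounded_op_linearD.
  rewrite [X in _ = _ + X]bounded_op_subE.
  by rewrite (Pid s)// subrr addr0.
have solves0 x : solves 0 x -> x = 0.
  move=> [Qx]; rewrite bounded_op_linear0 bounded_op_subE => /eqP.
  rewrite subr_eq0 => /eqP PU.
  suff Ux : U x = 0 by rewrite -Qx Qid// -kE.
  by apply: Uw0; [exists x|rewrite -[U x]bounded_op_1E -PU; exact: Pw].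
have solvesP a x x' y y' : solves y x -> solves y' x' ->
    solves (a *: y + y') (a *: x + x').
  move=> [Qx Ux] [Qx' Ux']; split.
    by rewrite bounded_op_linearP Qx Qx' scaler0 addr0.
  by rewrite !bounded_op_linearP Ux Ux'.
have uniq y x x' : solves y x -> solves y x' -> x = x'.
  move=> yx yx'; apply/esym/eqP; rewrite -subr_eq0; apply/eqP/solves0.
  rewrite -(addNr y) (addrC x') -[- y]scaleN1r -[- x]scaleN1r; exact: solvesP.
(* existence and uniqueness of solutions make V a linear function *)
have [V VP] := choice solve.
have Vlin : linear V.
  by move=> a y y'; apply: uniq (VP _) _; exact: solvesP.
have Vreal : linear (V : realify E -> realify E).
  by move=> t y y'; exact: Vlin.
pose Vl : {linear realify E -> realify E} :=
  HB.pack (V : realify E -> realify E)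
    (GRing.isLinear.Build _ _ _ _ (V : realify E -> realify E) Vreal).
(* the graph of V is given by Q x = 0 and (P - 1) U x = (P - 1) y *)
have [u y x uy ux|M VM] := @closed_graph R (realify E) (realify E) Vl.
  apply: uniq (VP y) _; split.
    apply: (bounded_op_cvg_eq (T := 0) ux uy) => j.
    exact: (VP _).1.
  apply: (bounded_op_cvg_eq (S := (P - 1) * U) ux uy) => j.
  exact: (VP _).2.
have Vbl : V \in @bounded_linear _ E.
  apply/bounded_linearP; split => //; exists (real_complex R M) => z.
  by rewrite !real_normE -rmorphM lecR; exact: VM.
exists (BoundedOp Vbl), Q, m, k; split => //; apply: bounded_op_eqP => x.
apply: uniq (VP _) _; rewrite bounded_op_subE bounded_op_1E; split.
  by rewrite bounded_op_linearB QQ subrr.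
by rewrite bounded_op_linearB UQ subr0.
Qed.

End Banach.
End Operators.

(** * Maximal left ideals *)

Theorem corollary4p1 (R : realType) (E : completeNormedModType R[i])
    (E_neq0 : exists x : E, x != 0) (L : set 'B(E))
    (L_max : maximal_left_ideal L) :
  (fixed_left_ideal L \/ inessential E `<=` L) /\
  ~ (fixed_left_ideal L /\ inessential E `<=` L).
Proof.
have [[L0 LD LM] LT Lmax] := L_max; split; last first.
  move=> [[x x0 LE] ELL]; have [S [Sx Sspan]] := exists_rank_one x x0.
  have := ELL _ (rank_one_inessential Sspan).
  by rewrite LE /= Sx; exact/eqP.
apply/or_asboolP; rewrite -implyNb; apply/implyP => /asboolPn Lfix.
(* otherwise L lies in the proper left ideal of operators killing x, so L is
   that ideal and is fixed *)
have Lsep x : x != 0 -> exists2 T, L T & T x != 0.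
  move=> x0; apply: contrapT => Lx; apply: Lfix; exists x => //.
  apply/esym/Lmax.
  - split=> [//|S T|S T]; rewrite /mkset.
      by rewrite bounded_op_addE => -> ->; rewrite addr0.
    by rewrite bounded_op_mulE => ->; rewrite bounded_op_linear0.
  - move=> xT; have : [set T : 'B(E) | T x = 0] 1 by rewrite xT.
    by rewrite /mkset bounded_op_1E; exact/eqP.
  - by move=> T LT' /=; apply: contrapT => /eqP Tx; apply: Lx; exists T.
apply/asboolP => T TE; apply: contrapT => LNT.
have L1 : ~ L 1.
  move=> L1; apply: LT; apply/seteqP; split => // S _.
  by rewrite -[S]mulr1; exact: LM.
pose J := [set U + S * T | U in L & S in [set: 'B(E)]].
have JT : J = setT.
  apply: contrapT => JNT; apply: LNT; rewrite -(Lmax J)//.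
  - by exists 0 => //; exists 1 => //; rewrite add0r mul1r.
  - split; first by exists 0 => //; exists 0 => //; rewrite add0r mul0r.
      move=> _ _ [U LU [S _ <-]] [U' LU' [S' _ <-]].
      exists (U + U'); first exact: LD.
      by exists (S + S') => //; rewrite mulrDl addrACA.
    move=> S' _ [U LU [S _ <-]]; exists (S' * U); first exact: LM.
    by exists (S' * S) => //; rewrite mulrDr mulrA.
  - by move=> U LU; exists U => //; exists 0 => //; rewrite mul0r addr0.
have : J 1 by rewrite JT.
move=> [U LU [S _ US]].
have fU : fredholm U by rewrite (_ : U = 1 - S * T)// -US addrK.
have [V [Q [n [v [VU Qv]]]]] := fredholm_left_parametrix fU.
by apply/L1/(left_ideal_unit (And3 L0 LD LM) Lsep Qv); rewrite -VU; exact: LM.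
Qed.
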